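(* Let $E\in\{\mathscr D_a(\mathbb R),\mathscr D(\mathbb R),\mathscr S(\mathbb R)\}$ (with $a>0$), $U\in\mathcal N(E)$ and $\gamma\in C(0)$. Then for every $\xi_0\in E$ and $f_0\in E^{(\gamma,U)}$ there is a $V\in\mathcal N(E)$ such that the equation $y'=0$ has a solution $f\in E^{(\gamma,V)}$, given by $$f(\xi)=f_0\Big[\Big(\int_{-\infty}^\infty\xi(x)\,dx\Big)\xi_0\Big],\qquad \xi\in E.$$ If $f_0=1$ (that is, $f_0(\xi)=\int_{-\infty}^\infty\xi(x)\,dx$), then $f_0\in E'$ and $f(\xi)=\int_{-\infty}^\infty\big(\int_{-\infty}^\infty\xi_0(\tau)\,d\tau\big)\xi(x)\,dx$ for all $\xi\in E$; that is, $f=\int_{-\infty}^\infty\xi_0(\tau)\,d\tau\in E'$ is a constant, which is a usual solution of the equation $y'=0$.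
   Context: Test function spaces on $\mathbb R$, over $\mathbb C$: for $a>0$, $\mathscr D_a(\mathbb R)$ is the Fréchet space of infinitely differentiable $\xi:\mathbb R\to\mathbb C$ with $\xi(x)=0$ for $|x|>a$, with norms $\|\xi\|_p=\sup_{|x|\le a}\max_{q\le p}|\xi^{(q)}(x)|$, $p=0,1,2,\dots$; $\mathscr D(\mathbb R)=\bigcup_{m\ge1}\mathscr D_m(\mathbb R)$ is the strict inductive limit; $\mathscr S(\mathbb R)$ is the Fréchet space of infinitely differentiable rapidly decreasing functions with norms $\|\xi\|_p=\sup_{k,q\le p,\,x\in\mathbb R}|x^k\xi^{(q)}(x)|$. $\mathcal N(E)$ is the family of neighborhoods of $0$ in $E$. $C(0)$ is the set of functions $\gamma:\mathbb C\to\mathbb C$ with $\lim_{t\to0}\gamma(t)=\gamma(0)=0$ and $|\gamma(t)|\ge|t|$ for $|t|\le1$. For $\gamma\in C(0)$ and $U\in\mathcal N(E)$, $E^{(\gamma,U)}$ (demi-distributions) is the set of continuous $f:E\to\mathbb C$ with $f(0)=0$ such that for all $x\in E$, $u\in U$ and scalars $|t|\le1$ there are scalars $r,s$ with $|r-1|\le|\gamma(t)|$, $|s|\le|\gamma(t)|$ and $f(x+tu)=rf(x)+sf(u)$. $E'$ is the space of continuous linear functionals on $E$ (usual distributions). A constant $C$ is identified with the functional $\xi\mapsto\int_{-\infty}^\infty C\xi(x)\,dx$. The derivative of $y\in E^{(\gamma,U)}$ is $y':E\to\mathbb C$, $y'(\xi)=y(-\xi')$; $y'=0$ means $y'(\xi)=0$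 for all $\xi\in E$. *)

(* Defs.v *)
From HB Require Import structures.
From mathcomp Require Import all_boot all_order all_algebra.
From mathcomp Require Import all_classical all_reals all_analysis.
From mathcomp Require Import complex.

Set Implicit Arguments.
Unset Strict Implicit.
Unset Printing Implicit Defensive.

Import Order.TTheory GRing.Theory Num.Theory.
Import numFieldNormedType.Exports.
Import ComplexField.Normc.

Local Open Scope ring_scope.
Local Open Scope classical_set_scope.

Definition absolutely_convex (K : numFieldType) (E : lmodType K) (A : set E) :=
  forall (s t : K) (x y : E),
    `|s| + `|t| <= 1 -> A x -> A y -> A (s *: x + t *: y).

HB.factory Record Lmodule_hasZeroBase (K : numFieldType) E
    & GRing.Lmodule K E := {
  zbase : set (set E);
  zbase_nonempty : zbase !=set0;
  zbaseI : forall U V, zbase U -> zbase V ->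
    exists2 W, zbase W & W `<=` U `&` V;
  zbase_absconvex : forall U, zbase U -> absolutely_convex U;
  zbase_scale : forall U (t : K), zbase U ->
    exists2 V, zbase V & forall x, V x -> U (t *: x);
  zbase_absorbing : forall U x, zbase U ->
    exists2 e : K, 0 < e & forall t : K, `|t| < e -> U (t *: x)
}.

HB.builders Context K E & Lmodule_hasZeroBase K E.

Definition znbhs (x : E) : set_system E :=
  [set A | exists2 W, zbase W & forall u, W u -> A (x + u)].

Let zbase0 U : zbase U -> U 0.
Proof.
move=> bU; have [e e0 /(_ 0)] := zbase_absorbing 0 bU.
by rewrite normr0 scale0r; apply.
Qed.

Let zbaseZ U (s : K) x : zbase U -> `|s| <= 1 -> U x -> U (s *: x).
Proof.
move=> bU s1 Ux.
have := zbase_absconvex bU (s:=s) (t:=0) (x:=x) (y:=x).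
rewrite scale0r addr0; apply=> //.
by rewrite normr0 addr0.
Qed.

Let zbaseD U : zbase U ->
  exists2 V, zbase V & forall x y, V x -> V y -> U (x + y).
Proof.
move=> bU; have [V bV VU] := zbase_scale 2 bU; exists V => // x y Vx Vy.
have Nhalf : `|2^-1 : K| = 2^-1 by rewrite ger0_norm// invr_ge0.
have -> : x + y = 2^-1 *: (2 *: x) + 2^-1 *: (2 *: y).
  by rewrite !scalerA mulVf ?pnatr_eq0// !scale1r.
apply: zbase_absconvex => //; [|exact: VU|exact: VU].
by rewrite Nhalf -[2^-1]mul1r -splitr.
Qed.

HB.instance Definition _ := hasNbhs.Build E znbhs.

Let znbhs_filter (x : E) : ProperFilter (nbhs x).
Proof.
split.
  by move=> [W bW] /(_ 0); apply; exact: zbase0.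
split.
- by have [W bW] := zbase_nonempty; exists W.
- move=> A B [W bW WA] [V bV VB]; have [U bU UWV] := zbaseI bW bV.
  by exists U => // u /UWV[Wu Vu]; split; [exact: WA|exact: VB].
- by move=> A B AB [W bW WA]; exists W => // u /WA/AB.
Qed.

Let znbhs_singleton (x : E) (A : set E) : nbhs x A -> A x.
Proof. by move=> [W bW /(_ 0)]; rewrite addr0; apply; exact: zbase0. Qed.

Let znbhs_nbhs (x : E) (A : set E) : nbhs x A -> nbhs x (nbhs^~ A).
Proof.
move=> [W bW WA]; have [V bV VW] := zbaseD bW; exists V => // u Vu.
by exists V => // v Vv; rewrite -addrA; apply/WA/VW.
Qed.

HB.instance Definition _ := Nbhs_isNbhsTopological.Build E
  znbhs_filter znbhs_singleton znbhs_nbhs.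

Let znbhsB (x : E) W : zbase W -> nbhs x [set y | W (y - x)].
Proof. by move=> bW; exists W => // u Wu /=; rewrite addrAC subrr add0r. Qed.

Let zadd_continuous : continuous (fun x : E * E => x.1 + x.2).
Proof.
move=> [x y] A [W bW WA]; have [V bV VW] := zbaseD bW.
exists ([set z | V (z - x)], [set z | V (z - y)]).
  by split; exact: znbhsB.
move=> [a b] [/= Va Vb]; rewrite -[a](subrK x) -[b](subrK y).
by rewrite addrACA addrC; apply/WA/VW.
Qed.

Let zscale_continuous : continuous (fun z : K^o * E => z.1 *: z.2).
Proof.
move=> [k x] A [W bW WA]; have [V bV VW] := zbaseD bW.
have [e e0 Ve] := zbase_absorbing x bV.
pose M := `|k| + 1; have M0 : 0 < M by rewrite ltr_wpDl.
have [V' bV' V'V] := zbase_scale M bV.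
exists (ball (k : K^o) e `&` ball (k : K^o) 1, [set z | V' (z - x)]).
  split; last exact: znbhsB.
  by apply: filterI; apply: nbhsx_ballx.
move=> [l z] [/= [kle kl1] V'z].
rewrite -ball_normE/= in kle; rewrite -ball_normE/= in kl1.
have -> : l *: z = k *: x + ((l - k) *: x + l *: (z - x)).
  by rewrite scalerBl scalerBr [X in _ + X]addrC subrKA addrC subrK.
apply/WA/VW; first by apply: Ve; rewrite distrC.
have -> : l *: (z - x) = (l / M) *: (M *: (z - x)).
  by rewrite scalerA divfK ?gt_eqF.
apply: zbaseZ => //; last exact: V'V.
rewrite normrM normfV (gtr0_norm M0) ler_pdivrMr// mul1r.
rewrite -[l](subrK k) addrC (le_trans (ler_normD _ _))// lerD2l.
by rewrite ltW// distrC.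
Qed.

Let zinterior_convex (x : E) (W : set E) : zbase W ->
  convex_set [set y | nbhs y [set z | W (z - x)]].
Proof.
move=> bW y z l /[!inE]/= -[V bV VW] [V' bV' V'W].
have [U bU UVV'] := zbaseI bV bV'.
exists U => // u Uu; have [Vu V'u] := UVV' _ Uu.
have a0 : 0 <= l%:inum by exact: interval_inference.ge0.
have a1 : l%:inum <= 1 by exact: interval_inference.le1.
set a := l%:inum in a0 a1.
have -> : conv l y z + u = a *: (y + u) + (1 - a) *: (z + u).
  by rewrite !scalerDr addrACA -[a *: u + _]scalerDl [a + _]addrC subrK scale1r.
rewrite /= [X in W X](_ : _ = a *: (y + u - x) + (1 - a) *: (z + u - x)).
  apply: zbase_absconvex => //; [|exact: VW|exact: V'W].
  by rewrite !ger0_norm ?subr_ge0// addrC subrK.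
rewrite !(scalerBr _ _ x) addrACA -opprD -scalerDl.
by rewrite [a + _]addrC subrK scale1r.
Qed.

Let zlocally_convex :
  exists2 B : set_system E, (forall b, b \in B -> convex_set b) & basis B.
Proof.
exists [set B | open B /\ convex_set B]; first by move=> b /[!inE] -[].
split; first by move=> B [].
move=> x A [W bW WA]; exists [set y | nbhs y [set z | W (z - x)]]; last first.
  move=> y /= /nbhs_singleton/= Wyx; rewrite -[y](subrK x) addrC; exact: WA.
split; last exact: znbhsB.
split; last exact: zinterior_convex.
exact: open_interior.
Qed.

(* PreTopologicalLmod_isTvs only provides the uniform structure. *)
HB.instance Definition _ := PreTopologicalLmod_isTvs.Build K E
  zadd_continuous zscale_continuous zlocally_convex.
HB.instance Definition _ :=
  PreTopologicalNmodule_isTopologicalNmodule.Build E zadd_continuous.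
HB.instance Definition _ :=
  TopologicalNmodule_isTopologicalLmodule.Build K E zscale_continuous.
HB.instance Definition _ := Uniform_isTvs.Build K E zlocally_convex.

HB.end.

HB.factory Record Lmodule_hasSeminorms (R : realType) E
    & GRing.Lmodule R[i] E := {
  seminorm : nat -> E -> R;
  seminorm_homo : forall m n x, (m <= n)%N -> seminorm m x <= seminorm n x;
  seminormD : forall n x y, seminorm n (x + y) <= seminorm n x + seminorm n y;
  seminormZ : forall n t x, seminorm n (t *: x) <= normc t * seminorm n x
}.

HB.builders Context R E & Lmodule_hasSeminorms R E.

Let zball n (e : R) : set E := [set x | seminorm n x < e].

Let base : set (set E) := [set U | exists n, exists2 e, 0 < e & U = zball n e].

Let normc_ge0 (t : R[i]) : 0 <= normc t.
Proof. by case: t => a b; exact: sqrtr_ge0. Qed.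

Let seminorm0 n : seminorm n 0 <= 0.
Proof. by have := seminormZ n 0 0; rewrite scale0r normc0 mul0r. Qed.

Let seminormN n x : seminorm n (- x) <= seminorm n x.
Proof. by have := seminormZ n (-1) x; rewrite scaleN1r normcN normc1 mul1r. Qed.

Let seminorm_ge0 n x : 0 <= seminorm n x.
Proof.
have H : 0 <= seminorm n 0.
  by have := seminormD n 0 0; rewrite addr0 lerDl.
have := seminormD n x (- x); rewrite subrr => /(le_trans H) H1.
have := le_trans H1 (lerD (lexx _) (seminormN n x)).
by rewrite -mulr2n pmulrn_lge0.
Qed.

Let base_nonempty : base !=set0.
Proof. by exists (zball 0 1), 0%N, 1. Qed.

Let baseI U V : base U -> base V -> exists2 W, base W & W `<=` U `&` V.
Proof.
move=> [m [e e0 ->]] [n [f f0 ->]].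
exists (zball (maxn m n) (Num.min e f)).
  by exists (maxn m n), (Num.min e f); rewrite // lt_min e0.
move=> x; rewrite /zball/= lt_min => /andP[xe xf].
by split; apply: le_lt_trans; [|exact: xe| |exact: xf];
  apply: seminorm_homo; rewrite ?leq_maxl ?leq_maxr.
Qed.

Let base_absconvex U : base U -> absolutely_convex U.
Proof.
move=> [n [e e0 ->]] s t x y.
have -> : `|s| + `|t| = (normc s + normc t)%:C%C.
  by rewrite !normc_def !rmorphD/=; case: s t => [? ?] [? ?].
rewrite -[1]/(1%:C%C) lecR /zball/= => st xe ye.
pose M := Num.max (seminorm n x) (seminorm n y).
have M0 : 0 <= M by rewrite le_max seminorm_ge0.
rewrite (@le_lt_trans _ _ M) ?gt_max ?xe//.
rewrite (le_trans (seminormD _ _ _))//.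
rewrite (le_trans (lerD (seminormZ _ _ _) (seminormZ _ _ _)))//.
rewrite -[leRHS]mul1r (le_trans _ (ler_wpM2r M0 st))// mulrDl.
by rewrite lerD// ler_wpM2l ?normc_ge0// le_max lexx ?orbT.
Qed.

Let base_scale U (t : R[i]) : base U ->
  exists2 V, base V & forall x, V x -> U (t *: x).
Proof.
move=> [n [e e0 ->]]; have t1 : 0 < normc t + 1 by rewrite ltr_wpDl.
exists (zball n (e / (normc t + 1))).
  by exists n, (e / (normc t + 1)); rewrite // divr_gt0.
move=> x; rewrite /zball/= ltr_pdivlMr// => xe.
rewrite (le_lt_trans (seminormZ _ _ _))// (le_lt_trans _ xe)// mulrC.
by rewrite ler_wpM2l ?seminorm_ge0// lerDl.
Qed.

Let base_absorbing U x : base U ->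
  exists2 e : R[i], 0 < e & forall t : R[i], `|t| < e -> U (t *: x).
Proof.
move=> [n [e e0 ->]].
have x1 : 0 < seminorm n x + 1 by rewrite ltr_wpDl// seminorm_ge0.
exists (e / (seminorm n x + 1))%:C%C; first by rewrite ltcR divr_gt0.
move=> t; rewrite (_ : `|t| = (normc t)%:C%C); last first.
  by rewrite normc_def; case: t.
rewrite ltcR ltr_pdivlMr// => te; rewrite /zball/=.
rewrite (le_lt_trans (seminormZ _ _ _))// (le_lt_trans _ te)//.
by rewrite ler_wpM2l ?normc_ge0// lerDl.
Qed.

HB.instance Definition _ := Lmodule_hasZeroBase.Build R[i] E
  base_nonempty baseI base_absconvex base_scale base_absorbing.

HB.end.

Section smooth.
Context {R : realType}.
Implicit Types (u v : R -> R) (xi eta : R -> R[i]).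

Definition real_smooth u := forall n x, derivable (derive1n n u) x 1.

(* A function R -> R[i] is differentiated through its real and imaginary
   parts. *)
Definition smooth xi :=
  real_smooth (fun x => complex.Re (xi x)) /\
  real_smooth (fun x => complex.Im (xi x)).

Definition cderiven (n : nat) xi : R -> R[i] := fun x =>
  (derive1n n (fun y => complex.Re (xi y)) x +i*
   derive1n n (fun y => complex.Im (xi y)) x)%C.

Lemma derivable_lin u v (a b x : R) : derivable u x 1 -> derivable v x 1 ->
  derivable (fun y => a * u y + b * v y) x 1.
Proof.
move=> du dv; apply: (@derivableD _ _ _ (a *: u) (b *: v)); exact: derivableZ.
Qed.

Lemma derive1_lin u v (a b x : R) : derivable u x 1 -> derivable v x 1 ->
  derive1 (fun y => a * u y + b * v y) x = a * derive1 u x + b * derive1 v x.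
Proof.
move=> du dv; have -> : (fun y => a * u y + b * v y) = a *: u + b *: v.
  by apply/funext.
rewrite !derive1E (deriveD (@derivableZ _ _ _ u a _ _ du)
  (@derivableZ _ _ _ v b _ _ dv)).
by rewrite (deriveZ a du) (deriveZ b dv).
Qed.

Lemma derive1n_lin u v (a b : R) n : real_smooth u -> real_smooth v ->
  derive1n n (fun x => a * u x + b * v x) =
  (fun x => a * derive1n n u x + b * derive1n n v x).
Proof.
move=> su sv; elim: n => [|n IHn]; first by rewrite !derive1n0.
rewrite derive1nS IHn; apply/funext => x.
by rewrite (derive1_lin a b (su n x) (sv n x)) !derive1nS.
Qed.

Lemma real_smooth_lin u v (a b : R) : real_smooth u -> real_smooth v ->
  real_smooth (fun x => a * u x + b * v x).
Proof.
move=> su sv n x; rewrite (derive1n_lin _ _ _ su sv).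
exact: derivable_lin (su n x) (sv n x).
Qed.

Arguments real_smooth_lin {u v} a b _ _ n x.

Lemma derive1n_add u m n : derive1n n (derive1n m u) = derive1n (m + n) u.
Proof. by rewrite /derive1n addnC iterD. Qed.

Lemma ReZD (t : R[i]) xi eta :
  (fun x => complex.Re ((t *: xi + eta) x)) =
  (fun x => 1 * (complex.Re t * complex.Re (xi x) +
                 - complex.Im t * complex.Im (xi x)) +
            1 * complex.Re (eta x)).
Proof.
apply/funext => x; rewrite !mul1r -[(_ + _) x]/(t * xi x + eta x).
by case: t (xi x) (eta x) => [a b] [c d] [e f]/=; rewrite mulNr.
Qed.

Lemma ImZD (t : R[i]) xi eta :
  (fun x => complex.Im ((t *: xi + eta) x)) =
  (fun x => 1 * (complex.Re t * complex.Im (xi x) +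
                 complex.Im t * complex.Re (xi x)) +
            1 * complex.Im (eta x)).
Proof.
apply/funext => x; rewrite !mul1r -[(_ + _) x]/(t * xi x + eta x).
by case: t (xi x) (eta x) => [a b] [c d] [e f].
Qed.

Lemma smoothZD (t : R[i]) xi eta :
  smooth xi -> smooth eta -> smooth (t *: xi + eta).
Proof.
move=> [sr si] [tr ti]; split.
  rewrite ReZD.
  exact (real_smooth_lin _ _ (real_smooth_lin _ _ sr si) tr).
rewrite ImZD.
exact (real_smooth_lin _ _ (real_smooth_lin _ _ si sr) ti).
Qed.

Lemma cderivenZD n (t : R[i]) xi eta : smooth xi -> smooth eta ->
  cderiven n (t *: xi + eta) = t *: cderiven n xi + cderiven n eta.
Proof.
move=> [sr si] [tr ti]; apply/funext => x; rewrite /cderiven ReZD ImZD.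
rewrite (derive1n_lin _ _ _ (real_smooth_lin _ _ sr si) tr).
rewrite (derive1n_lin _ _ _ (real_smooth_lin _ _ si sr) ti).
rewrite (derive1n_lin _ _ _ sr si) (derive1n_lin _ _ _ si sr).
rewrite !mul1r.
rewrite -[RHS]/(t * _ + _).
case: t => a b; apply/eqP; rewrite eq_complex/=.
by apply/andP; split; apply/eqP; rewrite ?mulNr.
Qed.

Lemma derive1n_0 n : derive1n n (cst 0 : R -> R) = cst 0.
Proof.
elim: n => // n IHn; rewrite derive1nS IHn.
by apply/funext => y; rewrite derive1_cst.
Qed.

Lemma smooth0 : smooth 0.
Proof. by split=> n x; rewrite derive1n_0; exact: derivable_cst. Qed.

Lemma cderiven_0 n : cderiven n 0 = 0.
Proof. by apply/funext => x; rewrite /cderiven !derive1n_0. Qed.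

Lemma cderiven0E xi : cderiven 0 xi = xi.
Proof. by apply/funext => x; rewrite /cderiven/=; case: (xi x). Qed.

Lemma cderivenS n xi : cderiven n (cderiven 1 xi) = cderiven n.+1 xi.
Proof.
by rewrite -(add1n n); apply/funext => x; rewrite /cderiven -!derive1n_add.
Qed.

Lemma smooth_deriv xi : smooth xi -> smooth (cderiven 1 xi).
Proof.
by move=> [sr si]; split=> n x /=;
  [have := sr n.+1 x|have := si n.+1 x]; rewrite -(add1n n) -derive1n_add.
Qed.

End smooth.

Section sup_image.
Context {R : realType} {T : Type}.
Implicit Types (A B : set T) (f g h : T -> R).

Definition bounded_above_on A f := exists M, forall x, A x -> f x <= M.

Lemma sup_image_ub A f x : bounded_above_on A f -> A x -> f x <= sup (f @` A).
Proof.
move=> [M fM] Ax; apply: ub_le_sup; last by exists x.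
by exists M => _ [y Ay <-]; exact: fM.
Qed.

Lemma sup_image_le A f M : 0 <= M -> (forall x, A x -> f x <= M) ->
  sup (f @` A) <= M.
Proof.
move=> M0 fM; have [A0|/nonemptyPn A0] := pselect (f @` A !=set0).
  by apply: ge_sup => // _ [y Ay <-]; exact: fM.
by rewrite A0 sup0.
Qed.

Lemma sup_image_ge0 A f : (forall x, 0 <= f x) -> bounded_above_on A f ->
  0 <= sup (f @` A).
Proof.
move=> f0 bf; have [[_ [x Ax _]]|/nonemptyPn A0] := pselect (f @` A !=set0).
  exact: le_trans (f0 x) (sup_image_ub bf Ax).
by rewrite A0 sup0.
Qed.

Lemma sup_image_homo A B f g : (forall x, 0 <= g x) -> bounded_above_on B g ->
  (forall x, A x -> B x /\ f x <= g x) -> sup (f @` A) <= sup (g @` B).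
Proof.
move=> g0 bg fg; apply: sup_image_le => [|x /fg[Bx fgx]].
  exact: sup_image_ge0.
exact: le_trans fgx (sup_image_ub bg Bx).
Qed.

Lemma sup_imageD A f g h : (forall x, 0 <= f x) -> (forall x, 0 <= g x) ->
  bounded_above_on A f -> bounded_above_on A g ->
  (forall x, h x <= f x + g x) ->
  sup (h @` A) <= sup (f @` A) + sup (g @` A).
Proof.
move=> f0 g0 bf bg hfg; apply: sup_image_le => [|x Ax].
  by rewrite addr_ge0// sup_image_ge0.
by rewrite (le_trans (hfg x))// lerD// sup_image_ub.
Qed.

Lemma sup_imageZ A (c : R) f h : 0 <= c -> (forall x, 0 <= f x) ->
  bounded_above_on A f -> (forall x, h x <= c * f x) ->
  sup (h @` A) <= c * sup (f @` A).
Proof.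
move=> c0 f0 bf hf; apply: sup_image_le => [|x Ax].
  by rewrite mulr_ge0// sup_image_ge0.
by rewrite (le_trans (hf x))// ler_wpM2l// sup_image_ub.
Qed.

Lemma bounded_above_on_bigmax A (f : nat -> T -> R) p :
  (forall q, bounded_above_on A (f q)) ->
  exists2 M, 0 <= M & forall q x, (q <= p)%N -> A x -> f q x <= M.
Proof.
move=> /choice[M fM]; exists (\big[Num.max/0]_(q < p.+1) M q).
  exact: bigmax_ge_id.
move=> q x qp Ax; rewrite (le_trans (fM q x Ax))//.
exact: (le_bigmax _ (fun q : 'I_p.+1 => M q) (Ordinal (n := p.+1) (m := q) qp)).
Qed.

End sup_image.

Section normc_facts.
Context {R : realType}.
Implicit Types (x y : R[i]).

Lemma normc_nneg x : 0 <= normc x.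
Proof. by case: x => a b; exact: sqrtr_ge0. Qed.

Lemma normc_le_ReIm x : normc x <= `|complex.Re x| + `|complex.Im x|.
Proof.
case: x => a b /=; have Hn : 0 <= `|a| + `|b| by rewrite addr_ge0.
rewrite -(ger0_norm Hn) -sqrtr_sqr ler_sqrt ?sqr_ge0//.
rewrite sqrrD !real_normK ?num_real// -addrA lerD2l lerDr.
by rewrite mulrn_wge0// mulr_ge0.
Qed.

End normc_facts.

Section smooth_bounded.
Context {R : realType}.

Lemma real_smooth_bounded (u : R -> R) n (a : R) : real_smooth u ->
  bounded_above_on [set x | `|x| <= a] (fun x => `|derive1n n u x|).
Proof.
move=> su; have [a0|a0] := leP 0 a; last first.
  exists 0 => x /= xa.
  by have := le_lt_trans (normr_ge0 x) (le_lt_trans xa a0); rewrite ltxx.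
have cu : {within `[- a, a], continuous (fun x => `|derive1n n u x|)}.
  apply: continuous_subspaceT => x.
  apply: (continuous_comp _ (@norm_continuous _ _ _)).
  by apply: differentiable_continuous; apply/derivable1_diffP; exact: su.
have [|c _ uc] := EVT_max _ cu; first by rewrite ge0_cp.
by exists (`|derive1n n u c|) => x /= xa; apply: uc; rewrite in_itv/= -ler_norml.
Qed.

Lemma smooth_bounded (xi : R -> R[i]) n (a : R) : smooth xi ->
  bounded_above_on [set x | `|x| <= a] (fun x => normc (cderiven n xi x)).
Proof.
move=> [/(real_smooth_bounded n a)[M1 h1] /(real_smooth_bounded n a)[M2 h2]].
exists (M1 + M2) => x xa; rewrite (le_trans (normc_le_ReIm _))//.
by rewrite lerD//; [exact: h1|exact: h2].
Qed.

End smooth_bounded.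

Section Da.
Context {R : realType} (a : R).

Definition Da_pred : {pred R -> R[i]} :=
  fun xi => `[< smooth xi /\ forall x, a < `|x| -> xi x = 0 >].

Fact Da_submod_closed : submod_closed Da_pred.
Proof.
split; first by apply/asboolP; split=> //; exact: smooth0.
move=> t xi eta /asboolP[sxi xi0] /asboolP[seta eta0]; apply/asboolP.
split=> [|x ax]; first exact: smoothZD.
by rewrite -[LHS]/(t * xi x + eta x) xi0// eta0// mulr0 addr0.
Qed.

HB.instance Definition _ :=
  GRing.isSubmodClosed.Build R[i] (R -> R[i]) Da_pred Da_submod_closed.

Record Da := MkDa { Da_fun :> R -> R[i]; Da_funP : Da_fun \in Da_pred }.

HB.instance Definition _ := [isSub for Da_fun].
HB.instance Definition _ := [Choice of Da by <:].
HB.instance Definition _ := [SubChoice_isSubLmodule of Da by <:].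

Definition Da_norm (p : nat) (xi : Da) : R :=
  sup [set \big[Num.max/0]_(q < p.+1) normc (cderiven q xi x) |
       x in [set x : R | `|x| <= a]].

Lemma Da_smooth (xi : Da) : smooth xi.
Proof. by have /asboolP[] := Da_funP xi. Qed.

Let maxn_ge0 p (xi : Da) x :
  0 <= \big[Num.max/0]_(q < p.+1) normc (cderiven q xi x).
Proof. exact: bigmax_ge_id. Qed.

Let maxn_bounded p (xi : Da) : bounded_above_on [set x : R | `|x| <= a]
  (fun x => \big[Num.max/0]_(q < p.+1) normc (cderiven q xi x)).
Proof.
have [M M0 HM] := bounded_above_on_bigmax p
  (fun q => smooth_bounded q a (Da_smooth xi)).
by exists M => x ax; apply: bigmax_le => // q _; apply: HM => //; rewrite -ltnS.
Qed.

Let le_maxn p (q : 'I_p.+1) (xi : Da) x :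
  normc (cderiven q xi x) <=
  \big[Num.max/0]_(q < p.+1) normc (cderiven q xi x).
Proof. exact: (le_bigmax _ (fun q : 'I_p.+1 => normc (cderiven q xi x))). Qed.

Fact Da_norm_homo m n xi : (m <= n)%N -> Da_norm m xi <= Da_norm n xi.
Proof.
move=> mn; apply: sup_image_homo => // x ax; split=> //.
apply: (le_bigmax_ord xpredT (fun q => normc (cderiven q xi x))).
by rewrite ltnS.
Qed.

Fact Da_normD p xi eta : Da_norm p (xi + eta) <= Da_norm p xi + Da_norm p eta.
Proof.
apply: sup_imageD => // x; apply: bigmax_le => [|q _]; first exact: addr_ge0.
have -> : Da_fun (xi + eta) = 1 *: Da_fun xi + Da_fun eta by rewrite scale1r.
rewrite cderivenZD; [|exact: Da_smooth..].
rewrite scale1r (le_trans (le_normcD _ _))//.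
by apply: lerD; exact: (le_maxn q).
Qed.

Fact Da_normZ p (t : R[i]) xi : Da_norm p (t *: xi) <= normc t * Da_norm p xi.
Proof.
apply: sup_imageZ => //; first exact: normc_nneg.
move=> x; apply: bigmax_le => [|q _]; first by rewrite mulr_ge0// normc_nneg.
have -> : Da_fun (t *: xi) = t *: Da_fun xi + 0 by rewrite addr0.
rewrite cderivenZD ?cderiven_0 ?addr0; [|exact: Da_smooth|exact: smooth0].
rewrite -[(_ *: _) x]/(t * cderiven q xi x) normcM.
by rewrite ler_wpM2l ?normc_nneg//; exact: (le_maxn q).
Qed.

HB.instance Definition _ :=
  Lmodule_hasSeminorms.Build R Da Da_norm_homo Da_normD Da_normZ.

Fact Da_deriv_subproof (xi : Da) : cderiven 1 xi \in Da_pred.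
Proof.
have /asboolP[sxi xi0] := Da_funP xi; apply/asboolP.
split=> [|x ax]; first exact: smooth_deriv.
have near0 : \forall y \near x, xi y = 0.
  have : \forall y \near x, a < `|y|.
    have /cvgr_gt := @norm_continuous R R x; exact.
  by apply: filterS => y /xi0.
have d0 (f : R[i] -> R) : f 0 = 0 -> derive1 (fun y => f (xi y)) x = 0.
  move=> f0; rewrite derive1E (@near_eq_derive _ _ _ _ (cst 0)) ?derive_cst//.
  by apply: filterS near0 => y ->.
by rewrite /cderiven !derive1n1 !d0.
Qed.

Definition Da_deriv (xi : Da) : Da := MkDa (Da_deriv_subproof xi).

End Da.

Section schwartz.
Context {R : realType}.

Definition schwartz_pred : {pred R -> R[i]} :=
  fun xi => `[< smooth xi /\ forall k q : nat,
    exists M : R, forall x, normc ((x ^+ k)%:C%C * cderiven q xi x) <= M >].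

Let term (z : nat * nat * R) (xi : R -> R[i]) :=
  normc ((z.2 ^+ z.1.1)%:C%C * cderiven z.1.2 xi z.2).

Let termZD z (t : R[i]) xi eta : smooth xi -> smooth eta ->
  term z (t *: xi + eta) <= normc t * term z xi + term z eta.
Proof.
move=> sxi seta; rewrite /term cderivenZD//.
rewrite -[(_ + _) z.2]/(t * cderiven z.1.2 xi z.2 + cderiven z.1.2 eta z.2).
by rewrite mulrDr mulrCA (le_trans (le_normcD _ _))// normcM.
Qed.

Fact schwartz_submod_closed : submod_closed schwartz_pred.
Proof.
split.
  apply/asboolP; split=> [|k q]; first exact: smooth0.
  by exists 0 => x; rewrite cderiven_0 mulr0 normc0.
move=> t xi eta /asboolP[sxi xib] /asboolP[seta etab]; apply/asboolP.
split=> [|k q]; first exact: smoothZD.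
have [M xiM] := xib k q; have [N etaN] := etab k q.
exists (normc t * M + N) => x; rewrite (le_trans (termZD (k, q, x) _ _ _))//.
by apply: lerD; [apply: ler_wpM2l; [exact: normc_nneg|exact: xiM]|exact: etaN].
Qed.

HB.instance Definition _ :=
  GRing.isSubmodClosed.Build R[i] (R -> R[i]) schwartz_pred
    schwartz_submod_closed.

Record schwartz := MkSchwartz {
  schwartz_fun :> R -> R[i];
  schwartz_funP : schwartz_fun \in schwartz_pred }.

HB.instance Definition _ := [isSub for schwartz_fun].
HB.instance Definition _ := [Choice of schwartz by <:].
HB.instance Definition _ := [SubChoice_isSubLmodule of schwartz by <:].

Definition schwartz_norm (p : nat) (xi : schwartz) : R :=
  sup [set r | exists k q x, [/\ (k <= p)%N, (q <= p)%N &
    r = normc ((x ^+ k)%:C%C * cderiven q xi x)]].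

Lemma schwartz_smooth (xi : schwartz) : smooth xi.
Proof. by have /asboolP[] := schwartz_funP xi. Qed.

Let range (p : nat) : set (nat * nat * R) :=
  [set z | (z.1.1 <= p)%N /\ (z.1.2 <= p)%N].

Let schwartz_normE p xi :
  schwartz_norm p xi = sup ((fun z => term z xi) @` range p).
Proof.
congr sup; apply/seteqP; split=> [r [k [q [x [kp qp ->]]]]|].
  by exists (k, q, x).
by move=> _ [[[k q] x] [/= kp qp] <-]; exists k, q, x.
Qed.

Let term_ge0 z xi : 0 <= term z xi. Proof. exact: normc_nneg. Qed.

Let term_bounded p (xi : schwartz) :
  bounded_above_on (range p) (fun z => term z xi).
Proof.
have /asboolP[_ xib] := schwartz_funP xi.
have bk k : bounded_above_on [set x | True]
    (fun x => \big[Num.max/0]_(q < p.+1) term (k, nat_of_ord q, x) xi).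
  have [|M M0 HM] := @bounded_above_on_bigmax _ _ [set x | True]
      (fun q x => term (k, q, x) xi) p.
    by move=> q; have [M HM] := xib k q; exists M => x _; exact: HM.
  exists M => x _; apply: bigmax_le => // q _; apply: HM => //.
  by rewrite -ltnS.
have [M M0 HM] := bounded_above_on_bigmax p bk.
exists M => -[[k q] x] [/= kp qp]; apply: le_trans (HM k x kp _) => //.
exact: (le_bigmax _ (fun q : 'I_p.+1 => term (k, nat_of_ord q, x) xi)
  (Ordinal (n := p.+1) (m := q) qp)).
Qed.

Fact schwartz_norm_homo m n xi : (m <= n)%N ->
  schwartz_norm m xi <= schwartz_norm n xi.
Proof.
move=> mn; rewrite !schwartz_normE; apply: sup_image_homo => //.
by move=> z [km qm]; split=> //; split; exact: leq_trans mn.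
Qed.

Fact schwartz_normD p xi eta :
  schwartz_norm p (xi + eta) <= schwartz_norm p xi + schwartz_norm p eta.
Proof.
rewrite !schwartz_normE; apply: sup_imageD => // z.
have -> : schwartz_fun (xi + eta) = 1 *: schwartz_fun xi + schwartz_fun eta.
  by rewrite scale1r.
rewrite (le_trans (termZD _ _ (schwartz_smooth _) (schwartz_smooth _)))//.
by rewrite normc1 mul1r.
Qed.

Fact schwartz_normZ p (t : R[i]) xi :
  schwartz_norm p (t *: xi) <= normc t * schwartz_norm p xi.
Proof.
rewrite !schwartz_normE; apply: sup_imageZ => //; first exact: normc_nneg.
move=> z; have -> : schwartz_fun (t *: xi) = t *: schwartz_fun xi + 0.
  by rewrite addr0.
rewrite (le_trans (termZD _ _ (schwartz_smooth _) smooth0))//.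
by rewrite {2}/term cderiven_0 mulr0 normc0 addr0.
Qed.

HB.instance Definition _ := Lmodule_hasSeminorms.Build R schwartz
  schwartz_norm_homo schwartz_normD schwartz_normZ.

Fact schwartz_deriv_subproof (xi : schwartz) :
  cderiven 1 xi \in schwartz_pred.
Proof.
have /asboolP[sxi xib] := schwartz_funP xi; apply/asboolP.
split=> [|k q]; first exact: smooth_deriv.
by have [M HM] := xib k q.+1; exists M => x; rewrite cderivenS.
Qed.

Definition schwartz_deriv (xi : schwartz) : schwartz :=
  MkSchwartz (schwartz_deriv_subproof xi).

End schwartz.
Arguments schwartz R : clear implicits.

Section D.
Context {R : realType}.

Definition D_pred : {pred R -> R[i]} :=
  fun xi => `[< smooth xi /\
    exists m : nat, forall x, m.+1%:R < `|x| -> xi x = 0 >].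

Fact D_submod_closed : submod_closed D_pred.
Proof.
split; first by apply/asboolP; split; [exact: smooth0|exists 0%N].
move=> t xi eta /asboolP[sxi [m xi0]] /asboolP[seta [n eta0]]; apply/asboolP.
split=> [|]; first exact: smoothZD.
exists (maxn m n) => x; rewrite -maxnSS natr_max gt_max => /andP[mx nx].
by rewrite -[LHS]/(t * xi x + eta x) xi0// eta0// mulr0 addr0.
Qed.

HB.instance Definition _ :=
  GRing.isSubmodClosed.Build R[i] (R -> R[i]) D_pred D_submod_closed.

Record D := MkD { D_fun :> R -> R[i]; D_funP : D_fun \in D_pred }.

HB.instance Definition _ := [isSub for D_fun].
HB.instance Definition _ := [Choice of D by <:].
HB.instance Definition _ := [SubChoice_isSubLmodule of D by <:].

Fact D_incl_subproof m (xi : Da (m.+1%:R : R)) : Da_fun xi \in D_pred.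
Proof.
by have /asboolP[sxi xi0] := Da_funP xi; apply/asboolP; split=> //; exists m.
Qed.

Definition D_incl m (xi : Da (m.+1%:R : R)) : D := MkD (D_incl_subproof xi).

(* The locally convex inductive limit of the spaces D_1, D_2, ... : an
   absolutely convex set is a neighborhood of 0 iff so is its trace on each of
   them. *)
Definition D_zbase : set (set D) :=
  [set W | absolutely_convex W /\
    forall m, nbhs (0 : Da m.+1%:R) (@D_incl m @^-1` W)].

Let D_inclZ m t (xi : Da (m.+1%:R : R)) : D_incl (t *: xi) = t *: D_incl xi.
Proof. exact: val_inj. Qed.

Fact D_zbase_nonempty : D_zbase !=set0.
Proof. by exists setT; split=> // m; exact: filterT. Qed.

Fact D_zbaseI U V : D_zbase U -> D_zbase V ->
  exists2 W, D_zbase W & W `<=` U `&` V.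
Proof.
move=> [cU nU] [cV nV]; exists (U `&` V) => //; split; last first.
  by move=> m; apply: filterI; [exact: nU|exact: nV].
by move=> s t x y st [Ux Vx] [Uy Vy]; split; [exact: cU|exact: cV].
Qed.

Fact D_zbase_absconvex U : D_zbase U -> absolutely_convex U.
Proof. by case. Qed.

Fact D_zbase_scale U (t : R[i]) : D_zbase U ->
  exists2 V, D_zbase V & forall x, V x -> U (t *: x).
Proof.
move=> [cU nU]; exists [set x | U (t *: x)] => //; split.
  move=> r s x y rs /= Ux Uy.
  rewrite scalerDr !scalerA ![t * _]mulrC -!scalerA; exact: cU.
move=> m; have := @scale_continuous R[i] (Da (m.+1%:R : R)) (t, 0).
rewrite /continuous_at/= scaler0 => /(_ _ (nU m))[[A B] [/= nA nB] AB].
apply: filterS nB => x Bx /=; rewrite -D_inclZ.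
by apply: (AB (t, x)); split=> //; exact: nbhs_singleton.
Qed.

Fact D_zbase_absorbing U (xi : D) : D_zbase U ->
  exists2 e : R[i], 0 < e & forall t : R[i], `|t| < e -> U (t *: xi).
Proof.
move=> [cU nU]; have /asboolP[sxi [m xi0]] := D_funP xi.
have xiP : D_fun xi \in Da_pred (m.+1%:R : R) by apply/asboolP; split.
have -> : xi = D_incl (MkDa xiP) by exact: val_inj.
have := @scale_continuous R[i] (Da (m.+1%:R : R)) (0, MkDa xiP).
rewrite /continuous_at/= scale0r => /(_ _ (nU m))[[A B] [/= nA nB] AB].
have [e /= e0 eA] := nA; exists e => // t te; rewrite -D_inclZ.
apply: (AB (t, MkDa xiP)); split; last exact: nbhs_singleton.
by apply: eA; rewrite /= sub0r normrN.
Qed.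

HB.instance Definition _ := Lmodule_hasZeroBase.Build R[i] D
  D_zbase_nonempty D_zbaseI D_zbase_absconvex D_zbase_scale D_zbase_absorbing.

Fact D_deriv_subproof (xi : D) : cderiven 1 xi \in D_pred.
Proof.
have /asboolP[sxi [m xi0]] := D_funP xi.
have xiP : D_fun xi \in Da_pred (m.+1%:R : R) by apply/asboolP; split.
have /asboolP[? ?] := Da_deriv_subproof (MkDa xiP).
by apply/asboolP; split=> //; exists m.
Qed.

Definition D_deriv (xi : D) : D := MkD (D_deriv_subproof xi).

End D.
Arguments D R : clear implicits.

Section neighborhoods_of_0.
Context {R : realType}.

Lemma nbhs0_Da (a : R) (A : set (Da a)) : nbhs (0 : Da a) A <->
  exists p, exists2 e : R, 0 < e & [set xi | Da_norm p xi < e] `<=` A.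
Proof.
split=> [[_ [p [e e0 ->]] WA]|[p [e e0 eA]]].
  by exists p, e => // xi xie; rewrite -[xi]add0r; exact: WA.
exists [set xi | Da_norm p xi < e]; first by exists p, e.
by move=> xi xie; rewrite add0r; exact: eA.
Qed.

Lemma nbhs0_schwartz (A : set (schwartz R)) : nbhs (0 : schwartz R) A <->
  exists p, exists2 e : R, 0 < e & [set xi | schwartz_norm p xi < e] `<=` A.
Proof.
split=> [[_ [p [e e0 ->]] WA]|[p [e e0 eA]]].
  by exists p, e => // xi xie; rewrite -[xi]add0r; exact: WA.
exists [set xi | schwartz_norm p xi < e]; first by exists p, e.
by move=> xi xie; rewrite add0r; exact: eA.
Qed.

Lemma nbhs0_D (A : set (D R)) : nbhs (0 : D R) A <->
  exists2 W, D_zbase W & W `<=` A.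
Proof.
split=> [[W bW WA]|[W bW WA]]; exists W => // xi Wxi.
  by rewrite -[xi]add0r; exact: WA.
by rewrite add0r; exact: WA.
Qed.

End neighborhoods_of_0.

HB.mixin Record isTestFunctionSpace (R : realType) E & Tvs R[i] E := {
  tfun : E -> R -> R[i];
  tfun_inj : injective tfun;
  tfun_linear : linear tfun;
  tderiv : E -> E;
  tfun_deriv : forall xi, tfun (tderiv xi) = cderiven 1 (tfun xi)
}.

#[short(type="testFunctionSpace")]
HB.structure Definition TestFunctionSpace (R : realType) :=
  {E of isTestFunctionSpace R E & Tvs R[i] E}.

Section instances.
Context {R : realType}.

Fact Da_fun_inj (a : R) : injective (@Da_fun R a).
Proof. exact: val_inj. Qed.

Fact Da_fun_linear (a : R) : linear (@Da_fun R a).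
Proof. by []. Qed.

Fact Da_fun_deriv (a : R) (xi : Da a) :
  Da_fun (Da_deriv xi) = cderiven 1 (Da_fun xi).
Proof. by []. Qed.

HB.instance Definition _ (a : R) := isTestFunctionSpace.Build R (Da a)
  (@Da_fun_inj a) (@Da_fun_linear a) (@Da_fun_deriv a).

Fact D_fun_inj : injective (@D_fun R).
Proof. exact: val_inj. Qed.

Fact D_fun_linear : linear (@D_fun R).
Proof. by []. Qed.

Fact D_fun_deriv (xi : D R) :
  D_fun (D_deriv xi) = cderiven 1 (D_fun xi).
Proof. by []. Qed.

HB.instance Definition _ := isTestFunctionSpace.Build R (D R)
  (@D_fun_inj) (@D_fun_linear) (@D_fun_deriv).

Fact schwartz_fun_inj : injective (@schwartz_fun R).
Proof. exact: val_inj. Qed.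

Fact schwartz_fun_linear : linear (@schwartz_fun R).
Proof. by []. Qed.

Fact schwartz_fun_deriv (xi : schwartz R) :
  schwartz_fun (schwartz_deriv xi) = cderiven 1 (schwartz_fun xi).
Proof. by []. Qed.

HB.instance Definition _ := isTestFunctionSpace.Build R (schwartz R)
  (@schwartz_fun_inj) (@schwartz_fun_linear) (@schwartz_fun_deriv).

End instances.

Variant is_Da_D_or_S (R : realType) : testFunctionSpace R -> Prop :=
| Is_Da (a : R) of 0 < a : is_Da_D_or_S (Da a)
| Is_D : is_Da_D_or_S (D R)
| Is_S : is_Da_D_or_S (schwartz R).

(* In what follows R[i]^o is R[i] with its usual topology. *)

Definition class_C0 (R : realType) : set (R[i] -> R[i]) :=
  [set gamma | [/\ gamma t @[t --> (0 : R[i]^o)^'] --> (0 : R[i]^o),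
                   gamma 0 = 0 &
                   forall t, `|t| <= 1 -> `|t| <= `|gamma t|]].

Definition demi_distribution (R : realType) (E : testFunctionSpace R)
    (gamma : R[i] -> R[i]) (U : set E) : set (E -> R[i]) :=
  [set f | [/\ continuous (f : E -> R[i]^o),
               f 0 = 0 &
               forall (x u : E) (t : R[i]), U u -> `|t| <= 1 ->
                 exists r s, [/\ `|r - 1| <= `|gamma t|, `|s| <= `|gamma t| &
                                 f (x + t *: u) = r * f x + s * f u]]].

Definition usual_distribution (R : realType) (E : testFunctionSpace R) :
    set (E -> R[i]) :=
  [set f | continuous (f : E -> R[i]^o) /\ scalar f].

Definition dist_deriv (R : realType) (E : testFunctionSpace R)
  (y : E -> R[i]) : E -> R[i] := fun xi => y (- tderiv xi).

Definition cintegral (R : realType) (f : R -> R[i]) : R[i] :=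
  ((\int[lebesgue_measure]_x complex.Re (f x))%R +i*
   (\int[lebesgue_measure]_x complex.Im (f x))%R)%C.

Definition const_distribution (R : realType) (E : testFunctionSpace R)
  (c : R[i]) : E -> R[i] := fun xi => cintegral (fun x => c * tfun xi x).
Arguments const_distribution {R} E c.

(* Main.v *)
Require Import Defs.
From mathcomp Require Import all_boot all_order all_algebra.
From mathcomp Require Import all_classical all_reals all_analysis.
From mathcomp Require Import complex measurable_realfun.

(** Write [I xi] for the integral of the test function [xi]. Three facts about
    the functional [I] carry the proof; all follow from the bound
    [|xi x| <= M / (1 + x^2)], valid on each of the three spaces with [M] a
    multiple of a seminorm in the case of [D_a] and [S]
    ([Da_quadratic_decay], [schwartz_quadratic_decay]).
    - [I] is linear, because the bound makes every test function integrable
      ([cintegral_tfun_scalar]).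
    - [I] is continuous ([cintegral_tfun_continuous]). On [D_a] and [S] it is
      dominated by a seminorm; on the inductive limit [D], the sets
      [|I xi| < e] are absolutely convex and their traces on the steps [D_m]
      are neighborhoods of 0.
    - [I] vanishes on derivatives ([cintegral_tderiv]): the integral of [xi']
      over [[-n, n]] is [xi n - xi (- n)], which tends to 0.

    Hence [T xi = I xi *: xi0] is a continuous linear map from [E] to itself.
    Composing a demi-distribution [f0] for [U] with such a map gives a
    demi-distribution for [V = T^-1(U)], with the same [gamma] and the same
    scalars [r] and [s] ([demi_distribution_comp]). Since [T] kills
    derivatives, [f0 \o T] has derivative 0. When [f0 = I], the composite is
    [I xi * I xi0] by linearity, that is, the constant [I xi0]. *)

Set Implicit Arguments.
Unset Strict Implicit.
Unset Printing Implicit Defensive.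

Import Order.TTheory GRing.Theory Num.Theory.
Import numFieldNormedType.Exports.

Local Open Scope ring_scope.
Local Open Scope classical_set_scope.

(** * Real functions bounded by a multiple of 1 / (1 + x^2) *)

Section integrals_on_the_line.
Context {R : realType}.
Implicit Types (u : R -> R) (M : R).
Let mu : {measure set _ -> \bar R} := @lebesgue_measure R.

(** Twice the half-line integral, by parity. *)
Lemma integral_oneDsqrV : (\int[mu]_x ((oneDsqr x)^-1)%:E = (pi : R)%:E)%E.
Proof.
rewrite ge0_symfun_integralT; first last.
- by move=> x /=; rewrite /oneDsqr sqrrN.
- exact: continuous_oneDsqrV.
- by move=> x; rewrite invr_ge0.
by rewrite -set_itvcy integral0y_oneDsqr -EFinM mulrC divfK.
Qed.

Lemma integrable_oneDsqrV M :
  mu.-integrable setT (fun x : R => (M * (oneDsqr x)^-1)%:E).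
Proof.
under eq_fun do rewrite EFinM.
have mV : mu.-integrable setT (fun x : R => ((oneDsqr x)^-1)%:E); last first.
  exact: (integrableZl measurableT M mV).
apply/integrableP; split.
  apply/measurable_EFinP; apply: continuous_measurable_fun.
  exact: continuous_oneDsqrV.
under eq_integral do rewrite gee0_abs ?lee_fin ?invr_ge0//.
by rewrite integral_oneDsqrV ltry.
Qed.

(** [1 / (1 + x^2)] serves as the integrable majorant throughout: one bound
    covers compactly supported and rapidly decreasing functions alike. *)
Lemma decay_integrable u M : continuous u ->
  (forall x, `|u x| <= M * (oneDsqr x)^-1) ->
  mu.-integrable setT (EFin \o u).
Proof.
move=> cu uM; apply: le_integrable (integrable_oneDsqrV M) => //.
  by apply/measurable_EFinP; exact: continuous_measurable_fun.
by move=> x _ /=; rewrite lee_fin (le_trans (uM x))// ler_norm.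
Qed.

Lemma decay_Rintegral_le u M : continuous u ->
  (forall x, `|u x| <= M * (oneDsqr x)^-1) ->
  `|\int[mu]_x u x| <= M * pi.
Proof.
move=> cu uM; have iu := decay_integrable cu uM.
have iV := integrable_oneDsqrV 1.
apply: (le_trans (le_normr_Rintegral _ iu)) => //.
have -> : M * pi = \int[mu]_x (M * (oneDsqr x)^-1).
  rewrite RintegralZl//; first by rewrite /Rintegral integral_oneDsqrV.
  by under eq_fun do rewrite /= -[_^-1]mul1r.
apply: le_Rintegral => //; last exact: integrable_oneDsqrV.
exact: integrable_norm.
Qed.

Lemma decay_cvg0 u M : (forall x, `|u x| <= M * (oneDsqr x)^-1) ->
  u n%:R @[n --> \oo] --> (0 : R) /\ u (- n%:R) @[n --> \oo] --> (0 : R).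
Proof.
have M0 v : (forall x, `|v x| <= M * (oneDsqr x)^-1) ->
    v n%:R @[n --> \oo] --> (0 : R).
  move=> vM; apply: norm_cvg0; have h : M * n.+1%:R^-1 @[n --> \oo] --> (0 : R).
    by rewrite -(mulr0 M); apply: cvgMr; exact: cvg_harmonic.
  apply: squeeze_cvgr h; last exact: cvg_cst.
  near=> n; rewrite normr_ge0/= (le_trans (vM _))//.
  have M_ge0 : 0 <= M.
    have := le_trans (normr_ge0 _) (vM 0).
    by rewrite /oneDsqr expr0n addr0 invr1 mulr1.
  (* 1 + n <= 1 + n^2 *)
  apply: ler_wpM2l => //; rewrite lef_pV2 ?posrE//.
  rewrite /oneDsqr -natr1 addrC lerD2l -natrX ler_nat.
  by rewrite -mulnn leq_pmulr//; near: n; exact: nbhs_infty_gt.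
move=> uM; split; first exact: M0.
apply: (M0 (fun x => u (- x))) => x.
by rewrite (le_trans (uM _))// /oneDsqr sqrrN.
Unshelve. all: by end_near. Qed.

(** The integral over [[-n, n]] is [u n - u (- n)], which tends to 0; by
    dominated convergence it also tends to the integral over the line. *)
Lemma Rintegral_derive_eq0 u M : (forall x, derivable u x 1) ->
  continuous (derive1 u) ->
  (forall x, `|u x| <= M * (oneDsqr x)^-1) ->
  (forall x, `|derive1 u x| <= M * (oneDsqr x)^-1) ->
  \int[mu]_x derive1 u x = 0.
Proof.
move=> du cu' uM u'M.
have cu : continuous u.
  by move=> x; apply/differentiable_continuous/derivable1_diffP.
pose f n : R -> \bar R := (EFin \o (derive1 u)) \_ `[- n%:R, n%:R].
have mu' : measurable_fun setT (derive1 u) by exact: continuous_measurable_fun.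
have mf n : measurable_fun setT (f n).
  apply: (measurable_restrictT _ (measurable_itv _)).1.
  by apply/measurable_EFinP; exact: measurable_funTS.
have ff x : f n x @[n --> \oo] --> (derive1 u x)%:E.
  apply: cvg_near_cst; near=> n.
  rewrite /f patchE ifT// inE/= in_itv/= -ler_norml.
  by near: n; exact: nbhs_infty_ger.
have fg x n : (`|f n x| <= (M * (oneDsqr x)^-1)%:E)%E.
  rewrite /f patchE; case: ifPn => _; first by rewrite lee_fin.
  by rewrite abse0 lee_fin (le_trans _ (uM x)).
have [] := @dominated_convergence _ _ R mu setT measurableT f
  (EFin \o (derive1 u)) (fun x => (M * (oneDsqr x)^-1)%:E) mf.
- exact/measurable_EFinP.
- by apply: aeW => x _; exact: ff.
- exact: integrable_oneDsqrV.
- by apply: aeW => x n _; exact: fg.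
move=> _ _ fu'.
have fE : \forall n \near \oo,
    (u n%:R - u (- n%:R))%:E = (\int[mu]_x f n x)%E.
  near=> n; rewrite /f -integral_mkcond (@continuous_FTC2 _ _ u).
  - by [].
  - have n0 : (0 < n)%N by near: n; exact: nbhs_infty_gt.
    by rewrite (@lt_trans _ _ 0)// ?oppr_lt0 ltr0n.
  - exact: continuous_subspaceT.
  - split; first by move=> x _; exact: du.
    + exact/cvg_at_right_filter/cu.
    + exact/cvg_at_left_filter/cu.
  - by [].
have f0 : (\int[mu]_x f n x)%E @[n --> \oo] --> (0 : R)%:E.
  apply: cvg_trans (near_eq_cvg fE) _.
  apply: cvg_EFin; first by near=> n.
  have [u0 u0'] := decay_cvg0 uM.
  by rewrite -(subr0 0); exact: cvgB u0 u0'.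
by rewrite /Rintegral (cvg_unique _ fu' f0).
Unshelve. all: by end_near. Qed.

End integrals_on_the_line.

(** * Integrals of complex functions of quadratic decay *)

Local Notation normc := ComplexField.Normc.normc.

Section complex_integral.
Context {R : realType}.
Implicit Types (f g : R -> R[i]) (M : R).
Let mu : {measure set _ -> \bar R} := @lebesgue_measure R.

Definition quadratic_decay M f :=
  forall x, normc (f x) <= M * (oneDsqr x)^-1.

Lemma quadratic_decay_le M N f : M <= N ->
  quadratic_decay M f -> quadratic_decay N f.
Proof.
by move=> MN fM x; rewrite (le_trans (fM x))// ler_wpM2r// invr_ge0.
Qed.

Lemma normcE_abs (z : R[i]) : `|z| = (normc z)%:C%C.
Proof. by rewrite normc_def; case: z. Qed.

Lemma norm_Re_le_normc (z : R[i]) : `|complex.Re z| <= normc z.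
Proof. by rewrite -lecR -normcE_abs normc_ge_Re. Qed.

Lemma norm_Im_le_normc (z : R[i]) : `|complex.Im z| <= normc z.
Proof.
case: z => a b /=; rewrite -sqrtr_sqr ler_sqrt ?addr_ge0 ?sqr_ge0//.
by rewrite lerDr sqr_ge0.
Qed.

Lemma real_smooth_continuous n (u : R -> R) :
  real_smooth u -> continuous (derive1n n u).
Proof.
by move=> su x; apply/differentiable_continuous/derivable1_diffP; exact: su.
Qed.

Section decaying_function.
Variables (M : R) (f : R -> R[i]).
Hypotheses (sf : smooth f) (fM : quadratic_decay M f).

Let decayRe x : `|complex.Re (f x)| <= M * (oneDsqr x)^-1.
Proof. exact: le_trans (norm_Re_le_normc _) (fM x). Qed.

Let decayIm x : `|complex.Im (f x)| <= M * (oneDsqr x)^-1.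
Proof. exact: le_trans (norm_Im_le_normc _) (fM x). Qed.

Lemma integrable_Re : mu.-integrable setT (EFin \o (fun x => complex.Re (f x))).
Proof.
exact: (decay_integrable (real_smooth_continuous (n := 0) sf.1) decayRe).
Qed.

Lemma integrable_Im : mu.-integrable setT (EFin \o (fun x => complex.Im (f x))).
Proof.
exact: (decay_integrable (real_smooth_continuous (n := 0) sf.2) decayIm).
Qed.

(** The factor 2 comes from bounding [|z|] by [|Re z| + |Im z|]; [pi] is the
    integral of [1 / (1 + x^2)]. *)
Lemma normc_cintegral_le : normc (cintegral f) <= M * pi *+ 2.
Proof.
rewrite (le_trans (normc_le_ReIm _))// mulr2n lerD//.
  exact: (decay_Rintegral_le (real_smooth_continuous (n := 0) sf.1) decayRe).
exact: (decay_Rintegral_le (real_smooth_continuous (n := 0) sf.2) decayIm).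
Qed.

End decaying_function.

Lemma cintegralZD (t : R[i]) M N f g :
  smooth f -> quadratic_decay M f -> smooth g -> quadratic_decay N g ->
  cintegral (t *: f + g) = t * cintegral f + cintegral g.
Proof.
move=> sf fM sg gN.
have [iRf iIf] := (integrable_Re sf fM, integrable_Im sf fM).
have [iRg iIg] := (integrable_Re sg gN, integrable_Im sg gN).
have intZ (a : R) (u : R -> R) : mu.-integrable setT (EFin \o u) ->
    mu.-integrable setT (EFin \o (fun x => a * u x)).
  by move=> iu; exact: (integrableZl measurableT a iu).
have intD (u v : R -> R) : mu.-integrable setT (EFin \o u) ->
    mu.-integrable setT (EFin \o v) ->
    mu.-integrable setT (EFin \o (fun x => u x + v x)).
  by move=> iu iv; exact: (integrableD measurableT iu iv).
rewrite /cintegral ReZD ImZD.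
have comb (a b : R) (u v w : R -> R) : mu.-integrable setT (EFin \o u) ->
    mu.-integrable setT (EFin \o v) -> mu.-integrable setT (EFin \o w) ->
    \int[mu]_x (1 * (a * u x + b * v x) + 1 * w x) =
    a * \int[mu]_x u x + b * \int[mu]_x v x + \int[mu]_x w x.
  move=> iu iv iw.
  rewrite (@eq_Rintegral _ _ _ mu setT (fun x => a * u x + b * v x + w x)).
    rewrite RintegralD//; last by apply: intD; exact: intZ.
    by rewrite RintegralD//; [rewrite !RintegralZl|exact: intZ..].
  by move=> x _; rewrite !mul1r.
rewrite !comb//.
by case: t => a b; apply/eqP; rewrite eq_complex/= mulNr !eqxx.
Qed.

(** Both the function and its derivative must decay: the first makes the
    boundary terms vanish, the second makes the derivative integrable. *)
Lemma cintegral_cderiven1 M f :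
  smooth f -> quadratic_decay M f -> quadratic_decay M (cderiven 1 f) ->
  cintegral (cderiven 1 f) = 0.
Proof.
move=> sf fM f'M.
rewrite /cintegral /=.
rewrite !(@Rintegral_derive_eq0 _ _ M)//.
- by move=> x; exact: (sf.2 0%N).
- exact: (real_smooth_continuous (n := 1) sf.2).
- by move=> x; exact: le_trans (norm_Im_le_normc _) (fM x).
- by move=> x; exact: le_trans (norm_Im_le_normc _) (f'M x).
- by move=> x; exact: (sf.1 0%N).
- exact: (real_smooth_continuous (n := 1) sf.1).
- by move=> x; exact: le_trans (norm_Re_le_normc _) (fM x).
- by move=> x; exact: le_trans (norm_Re_le_normc _) (f'M x).
Qed.

End complex_integral.

(** * Decay of the test functions *)

Section decay_of_test_functions.
Context {R : realType}.

(** On the support, [1 + x^2] is at most [1 + a^2]. The constant is a multiple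
    of a seminorm, which is what makes the integral continuous. *)
Lemma Da_quadratic_decay (a : R) (xi : Da a) :
  quadratic_decay (Da_norm 0 xi * (1 + a ^+ 2)) xi.
Proof.
have [M xiM] := smooth_bounded 0 a (Da_smooth xi).
have nE : (fun x => \big[Num.max/0]_(q < 1) normc (cderiven q xi x)) =
    (fun x => normc (xi x)).
  apply/funext => x; rewrite big_ord_recl big_ord0 cderiven0E.
  by rewrite max_l// normc_nneg.
have bxi : bounded_above_on [set x : R | `|x| <= a] (fun x => normc (xi x)).
  by exists M => x /xiM; rewrite cderiven0E.
have N0 : 0 <= Da_norm 0 xi.
  by rewrite /Da_norm nE; apply: sup_image_ge0 => // x; exact: normc_nneg.
move=> x; rewrite ler_pdivlMr ?(lt_le_trans ltr01)//.
have [xa|ax] := leP `|x| a.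
  have xN : normc (xi x) <= Da_norm 0 xi.
    by rewrite /Da_norm nE; exact: (sup_image_ub bxi).
  apply: ler_pM => //; first exact: normc_nneg.
  rewrite /oneDsqr lerD2l -real_normK ?num_real//.
  by rewrite ler_pXn2r// ?nnegrE// (le_trans _ xa).
have /asboolP[_ ->//] := Da_funP xi.
by rewrite ComplexField.Normc.normc0 mul0r mulr_ge0// addr_ge0// sqr_ge0.
Qed.

(** The terms [k = 0] and [k = 2], at [q = 0], of the second seminorm bound
    [xi] and [x^2 xi]; add them up. *)
Lemma schwartz_quadratic_decay (xi : schwartz R) :
  quadratic_decay (schwartz_norm 2 xi *+ 2) xi.
Proof.
move=> x; rewrite ler_pdivlMr ?(lt_le_trans ltr01)//.
have /asboolP[_ xib] := schwartz_funP xi.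
(* The supremum defining the seminorm is over finitely many pairs (k, q), hence
   of a bounded set: B is the largest of the bounds given for these pairs. *)
pose M k := projT1 (choice (xib k)).
pose B := \big[Num.max/0]_(z : 'I_3 * 'I_3) M z.1 z.2.
have hx k : (k <= 2)%N ->
    normc ((x ^+ k)%:C%C * cderiven 0 xi x) <= schwartz_norm 2 xi.
  move=> k2; apply: ub_le_sup; last by exists k, 0%N, x.
  exists B => _ [j [q [y [j2 q2 ->]]]].
  apply: (le_trans (projT2 (choice (xib j)) q y)).
  exact: (le_bigmax _ (fun z : 'I_3 * 'I_3 => M z.1 z.2)
    (Ordinal (n := 3) (m := j) j2, Ordinal (n := 3) (m := q) q2)).
rewrite /oneDsqr mulrDr mulr1 mulr2n lerD//.
  by have := hx 0%N isT; rewrite cderiven0E mul1r.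
have := hx 2%N isT.
rewrite cderiven0E ComplexField.Normc.normcM mulrC.
by congr (_ * _ <= _); rewrite /= expr0n/= addr0 sqrtr_sqr ger0_norm// sqr_ge0.
Qed.

(** An element of [D] lies in some [D_m] and inherits its bound. *)
Lemma test_function_decay (E : testFunctionSpace R) : is_Da_D_or_S E ->
  forall xi : E, smooth (tfun xi) /\ exists M, quadratic_decay M (tfun xi).
Proof.
case=> [a _ | | ] xi.
- split; first exact: (Da_smooth xi).
  by eexists; exact: (Da_quadratic_decay xi).
- have /asboolP[sxi [m xi0]] := D_funP xi; split => //.
  have xiP : D_fun xi \in Da_pred (m.+1%:R : R) by apply/asboolP; split.
  by eexists; exact: (Da_quadratic_decay (MkDa xiP)).
- split; first exact: (schwartz_smooth xi).
  by eexists; exact: (schwartz_quadratic_decay xi).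
Qed.

End decay_of_test_functions.

(** * Continuity of linear functionals and composition of distributions *)

Section scalar_functionals.
Context {R : realType}.

Lemma scalar_ball_absolutely_convex (F : lmodType R[i]) (L : F -> R[i])
  (e : R) : scalar L -> absolutely_convex [set xi | normc (L xi) < e].
Proof.
move=> sL s t x y; rewrite !normcE_abs -rmorphD -[1]/(1%:C%C) lecR => st /= xe ye.
rewrite sL (scalable_linear sL).
pose m := Num.max (normc (L x)) (normc (L y)).
have m0 : 0 <= m by rewrite le_max normc_nneg.
apply: (@le_lt_trans _ _ m); last by rewrite gt_max xe.
rewrite (le_trans (le_normcD _ _))// !ComplexField.Normc.normcM.
rewrite -[leRHS]mul1r (le_trans _ (ler_wpM2r m0 st))//.
by rewrite mulrDl lerD// ler_wpM2l ?normc_nneg// le_max lexx ?orbT.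
Qed.

(** By translation, continuity at 0 suffices. *)
Lemma scalar_continuous (F : tvsType R[i]) (L : F -> R[i]) : scalar L ->
  (forall e : R, 0 < e -> nbhs (0 : F) [set xi | normc (L xi) < e]) ->
  continuous (L : F -> R[i]^o).
Proof.
move=> sL nL x; apply/cvgrPdist_lt => e e0.
have eE : e = (complex.Re e)%:C%C by rewrite RRe_real// ger0_real// ltW.
have Re_e0 : 0 < complex.Re e by rewrite -ltcR -eE.
have : nbhs x [set y | normc (L y - L x) < complex.Re e].
  apply: filterS (nbhsT x (nL _ Re_e0)) => _ [u /= Lu <-].
  by have := sL 1 u x; rewrite scale1r mul1r [u + x]addrC => ->; rewrite addrK.
by apply: filterS => y Ly; rewrite eE distrC normcE_abs ltcR.
Qed.

(** The scalars that [f0] provides for [T x] and [T u] serve for [x] and [u],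
    because [T] maps [x + t u] to [T x + t (T u)]. *)
Lemma demi_distribution_comp (E : testFunctionSpace R) (T : E -> E)
    (U : set E) (gamma : R[i] -> R[i]) (f0 : E -> R[i]) :
  continuous T -> linear T -> demi_distribution gamma U f0 ->
  demi_distribution gamma (T @^-1` U) (f0 \o T).
Proof.
move=> cT lT [cf0 f00 f0U].
have T0 : T 0 = 0 by have := scalable_linear lT 0 0; rewrite /= !scale0r.
split.
- by move=> xi; apply: continuous_comp; [exact: cT|exact: cf0].
- by rewrite /= T0.
- by move=> x u t Uu t1; rewrite /= addrC lT addrC; exact: f0U.
Qed.

End scalar_functionals.

(** * The integral as a functional on a space of test functions *)

Section integral_functional.
Context {R : realType} (E : testFunctionSpace R) (hE : is_Da_D_or_S E).
Implicit Types (xi : E) (c : R[i]).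

Lemma cintegral_tfun_scalar : scalar (fun xi : E => cintegral (tfun xi)).
Proof.
move=> t xi eta; rewrite tfun_linear.
have [[sx [M xM]] [se [N eN]]] :=
  (test_function_decay hE xi, test_function_decay hE eta).
exact: cintegralZD sx xM se eN.
Qed.

Lemma cintegral_tfunZ c xi :
  cintegral (tfun (c *: xi)) = c * cintegral (tfun xi).
Proof. exact: (scalable_linear cintegral_tfun_scalar). Qed.

Lemma cintegral_tderiv xi : cintegral (tfun (tderiv xi)) = 0.
Proof.
have [[sx [M xM]] [_ [N dN]]] :=
  (test_function_decay hE xi, test_function_decay hE (tderiv xi)).
rewrite tfun_deriv in dN *.
by apply: (@cintegral_cderiven1 _ (Num.max M N)) => //;
  [move: xM|move: dN]; apply: quadratic_decay_le; rewrite le_max lexx ?orbT.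
Qed.

(** On [D] it suffices to check the traces on the spaces [D_m], so this case
    reduces to that of [D_a]. *)
Lemma cintegral_tfun_nbhs0 (e : R) : 0 < e ->
  nbhs (0 : E) [set xi | normc (cintegral (tfun xi)) < e].
Proof.
move=> e0; have pi2_gt0 : 0 < pi *+ 2 :> R by rewrite mulrn_wgt0// pi_gt0.
have Da_case a : nbhs (0 : Da a) [set xi | normc (cintegral (tfun xi)) < e].
  have c0 : 0 < (1 + a ^+ 2) * (pi *+ 2).
    by rewrite mulr_gt0// ltr_wpDr// sqr_ge0.
  apply/nbhs0_Da; exists 0%N, (e / ((1 + a ^+ 2) * (pi *+ 2))).
    by rewrite divr_gt0.
  move=> xi /=; rewrite ltr_pdivlMr// mulrA mulrnAr; apply: le_lt_trans.
  exact: normc_cintegral_le (Da_smooth xi) (Da_quadratic_decay xi).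
move: cintegral_tfun_scalar; case: hE => [a _ _ | sI | _].
- exact: Da_case.
- apply/nbhs0_D; exists [set xi | normc (cintegral (tfun xi)) < e] => //.
  split; last by move=> m; exact: Da_case.
  exact: scalar_ball_absolutely_convex.
- have c0 : 0 < pi *+ 2 *+ 2 :> R by rewrite mulrn_wgt0.
  apply/nbhs0_schwartz; exists 2%N, (e / (pi *+ 2 *+ 2)).
    by rewrite divr_gt0.
  move=> xi /=; rewrite ltr_pdivlMr//; apply: le_lt_trans.
  have := normc_cintegral_le (schwartz_smooth xi) (schwartz_quadratic_decay xi).
  by rewrite mulrnAl -!mulrnAr.
Qed.

Lemma cintegral_tfun_continuous :
  continuous ((fun xi => cintegral (tfun xi)) : E -> R[i]^o).
Proof.
apply: scalar_continuous; first exact: cintegral_tfun_scalar.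
exact: cintegral_tfun_nbhs0.
Qed.

Lemma cintegral_scale_continuous (xi0 : E) :
  continuous (fun xi => cintegral (tfun xi) *: xi0).
Proof.
move=> xi; have cI := @cintegral_tfun_continuous xi.
have := @scale_continuous R[i] E (cintegral (tfun xi), xi0).
exact: (cvg_comp2 cI (cvg_cst _)).
Qed.

Lemma cintegral_scale_linear (xi0 : E) :
  linear (fun xi => cintegral (tfun xi) *: xi0).
Proof.
by move=> t x y; rewrite cintegral_tfun_scalar scalerDl scalerA.
Qed.

(** The multiple [c xi] is again a test function, and its integral is
    [c (I xi)]. *)
Lemma const_distributionE c xi :
  const_distribution E c xi = c * cintegral (tfun xi).
Proof.
rewrite -cintegral_tfunZ /const_distribution; congr cintegral.
by rewrite (scalable_linear (@tfun_linear _ E)).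
Qed.

Lemma usual_const_distribution c : usual_distribution (const_distribution E c).
Proof.
have -> : const_distribution E c = fun xi => cintegral (tfun xi) * c.
  by apply/funext => xi; rewrite const_distributionE mulrC.
split; first by move=> xi; apply: cvgMl; exact: cintegral_tfun_continuous.
by move=> t x y; rewrite cintegral_tfun_scalar mulrDl mulrA.
Qed.

Lemma dist_deriv_comp_cintegral (f0 : E -> R[i]) (xi0 xi : E) : f0 0 = 0 ->
  dist_deriv (fun xi => f0 (cintegral (tfun xi) *: xi0)) xi = 0.
Proof.
move=> f00; rewrite /dist_deriv -scaleN1r cintegral_tfunZ cintegral_tderiv.
by rewrite mulr0 scale0r.
Qed.

End integral_functional.

Theorem theorem2p3 (R : realType) (E : testFunctionSpace R)
  (hE : is_Da_D_or_S E) (U : set E) (hU : nbhs (0 : E) U)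
  (gamma : R[i] -> R[i]) (hgamma : class_C0 gamma) (xi0 : E) :
  (forall f0 : E -> R[i], demi_distribution gamma U f0 ->
     let f := fun xi : E => f0 (cintegral (tfun xi) *: xi0) in
     exists V : set E,
       [/\ nbhs (0 : E) V,
           demi_distribution gamma V f &
           (forall xi : E, dist_deriv f xi = 0)]) /\
  (forall f0 : E -> R[i], f0 = const_distribution E 1 ->
     let f := fun xi : E => f0 (cintegral (tfun xi) *: xi0) in
     ((forall xi : E, f0 xi = cintegral (tfun xi)) /\ usual_distribution f0) /\
     [/\ (forall xi : E,
            f xi = cintegral (fun x => cintegral (tfun xi0) * tfun xi x)),
         f = const_distribution E (cintegral (tfun xi0)),
         usual_distribution f &
         (forall xi : E, dist_deriv f xi = 0)]).
Proof.
split=> [f0 demi_f0 f|f0 -> f].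
  exists ((fun xi => cintegral (tfun xi) *: xi0) @^-1` U); split.
  - apply: (cintegral_scale_continuous hE (xi0 := xi0) (x := 0)).
    have I0 := cintegral_tfunZ hE 0 0; rewrite scale0r mul0r in I0.
    by rewrite I0 scale0r.
  - apply: demi_distribution_comp demi_f0.
      exact: cintegral_scale_continuous.
    exact: cintegral_scale_linear.
  - by move=> xi; apply: dist_deriv_comp_cintegral => //; case: demi_f0.
have fE : f = const_distribution E (cintegral (tfun xi0)).
  apply/funext => xi.
  by rewrite /f !const_distributionE// mul1r cintegral_tfunZ// mulrC.
split; first split.
- by move=> xi; rewrite const_distributionE// mul1r.
- exact: usual_const_distribution.
- split=> //.
  + by move=> xi; rewrite fE.
  + by rewrite fE; exact: usual_const_distribution.
  + move=> xi; apply: dist_deriv_comp_cintegral => //.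
    have := cintegral_tfunZ hE 0 0; rewrite scale0r mul0r => I0.
    by rewrite const_distributionE// I0 mulr0.
Qed.
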